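(* Let $>$ be a reduction order on $\mathcal{T}(\mathcal{F},\mathcal{V})$ and let $\mathcal{E}$ be a set of equations. For every fair finite run $(\mathcal{E}_0,\mathcal{R}_0)\vdash_{\mathsf f}(\mathcal{E}_1,\mathcal{R}_1)\vdash_{\mathsf f}\cdots\vdash_{\mathsf f}(\mathcal{E}_n,\mathcal{R}_n)$ for $\mathcal{E}$, the TRS $\mathcal{R}_n$ is a complete presentation of $\mathcal{E}$.
   Context: Terms are built from a signature $\mathcal{F}$ and an infinite set of variables $\mathcal{V}$. An equational system (ES) is a set of pairs of terms $s\approx t$; a term rewrite system (TRS) is a set of pairs $\ell\to r$ with $\ell$ not a variable and every variable of $r$ occurring in $\ell$. For a set $X$ of pairs of terms, $\to_X$ is its closure under contexts and substitutions, $\leftrightarrow_X$ the symmetric closure of $\to_X$, $\leftrightarrow_X^*$ the conversion relation, and $\downarrow_X\,=\,\to_X^*\cdot{}_X^*{\leftarrow}$ joinability. A TRS is complete if it is terminating and confluent; $\mathcal{R}$ is a complete presentation of $\mathcal{E}$ if $\mathcal{R}$ is complete and $\leftrightarrow_{\mathcal{R}}^*\,=\,\leftrightarrow_{\mathcal{E}}^*$. A reduction order is a well-founded strict order on terms closed under contexts and substitutions. Prime critical pairs: an overlap of $\mathcal{R}$ is a triple $\langle \ell_1\to r_1,p,\ell_2\to r_2\rangle$ where the two rules are variants (up to bijective variable renaming) of rules of $\mathcal{R}$ without common variables, $p$ is a non-variable position of $\ell_2$, $\ell_1$ and $\ell_2|_p$ are unifiable, and if $p=\epsilon$ the two rules are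 not variants of each other. With $\sigma$ a most general unifier of $\ell_1$ and $\ell_2|_p$, the critical pair is $\ell_2\sigma[r_1\sigma]_p\approx r_2\sigma$. It is prime if all proper subterms of $\ell_2\sigma|_p$ are normal forms with respect to $\mathcal{R}$. $\mathrm{PCP}(\mathcal{R})$ is the set of prime critical pairs of $\mathcal{R}$. Inference system $\mathsf{KB_f}$ (for the fixed reduction order $>$; $\uplus$ is disjoint union): $(\mathcal{E},\mathcal{R})\vdash_{\mathsf f}(\mathcal{E}',\mathcal{R}')$ if it is an instance of one of - deduce: $(\mathcal{E},\mathcal{R})\vdash(\mathcal{E}\cup\{s\approx t\},\mathcal{R})$ if $s\,{}_{\mathcal{R}}{\leftarrow}\cdot\to_{\mathcal{R}}t$; - orient: $(\mathcal{E}\uplus\{s\approx t\},\mathcal{R})\vdash(\mathcal{E},\mathcal{R}\cup\{s\to t\})$ if $s>t$, and $(\mathcal{E}\uplus\{s\approx t\},\mathcal{R})\vdash(\mathcal{E},\mathcal{R}\cup\{t\to s\})$ if $t>s$; - delete: $(\mathcal{E}\uplus\{s\approx s\},\mathcal{R})\vdash(\mathcal{E},\mathcal{R})$; - compose: $(\mathcal{E},\mathcal{R}\uplus\{s\to t\})\vdash(\mathcal{E},\mathcal{R}\cup\{s\to u\})$ if $t\to_{\mathcal{R}}u$; - simplify: $(\mathcal{E}\uplus\{s\approx t\},\mathcal{R})\vdash(\mathcal{E}\cup\{u\approx t\},\mathcal{R})$ if $s\to_{\mathcal{R}}u$, and $(\mathcal{E}\uplus\{s\approx t\},\mathcal{R})\vdash(\mathcal{E}\cup\{s\approx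 u\},\mathcal{R})$ if $t\to_{\mathcal{R}}u$; - collapse: $(\mathcal{E},\mathcal{R}\uplus\{t\to s\})\vdash(\mathcal{E}\cup\{u\approx s\},\mathcal{R})$ if $t\to_{\mathcal{R}}u$. A finite run for $\mathcal{E}$ is a finite sequence of $\vdash_{\mathsf f}$ steps as displayed with $\mathcal{E}_0=\mathcal{E}$ and $\mathcal{R}_0=\varnothing$. It is fair if $\mathcal{E}_n=\varnothing$ and $\mathrm{PCP}(\mathcal{R}_n)\subseteq{\downarrow_{\mathcal{R}_n}}\cup\bigcup_{i=0}^n{\leftrightarrow_{\mathcal{E}_i}}$. *)

(* Defs.v *)
From Stdlib Require Import Relation_Operators.
From mathcomp Require Import all_boot.
From mathcomp Require Import boolp classical_sets functions cardinality.

Set Implicit Arguments.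
Unset Strict Implicit.
Unset Printing Implicit Defensive.

Local Open Scope classical_set_scope.

Record signature := Signature { symbol :> Type; arity : symbol -> nat }.

Inductive term (F : signature) (V : Type) : Type :=
| Var of V
| App (f : F) of {ffun 'I_(arity f) -> term F V}.

Section Terms.
Context {F : signature} {V : Type}.
Local Notation T := (term F V).

Fixpoint vars (t : T) : set V :=
  match t with
  | Var x => [set x]
  | App _ ts => [set x | exists i, vars (ts i) x]
  end.

Fixpoint subst (s : V -> T) (t : T) : T :=
  match t with
  | Var x => s x
  | App f ts => App [ffun i => subst s (ts i)]
  end.

(* Positions are sequences of argument indices, counted from 0. *)
Definition position := seq nat.

(* [subterm_at t p] is None when p is not a position of t. *)
Fixpoint subterm_at (t : T) (p : position) {struct p} : option T :=
  match p with
  | [::] => Some t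
  | i :: q =>
    match t with
    | Var _ => None
    | App f ts =>
      if insub i is Some j then subterm_at (ts j) q else None
    end
  end.

Definition is_position (t : T) (p : position) : Prop :=
  exists u, subterm_at t p = Some u.

(* t[u]_p; the term t is returned unchanged when p is not a position of t. *)
Fixpoint replace_at (t : T) (p : position) (u : T) {struct p} : T :=
  match p with
  | [::] => u
  | i :: q =>
    match t with
    | Var _ => t
    | App f ts =>
      App [ffun j => if val j == i then replace_at (ts j) q u else ts j]
    end
  end.

(* Equations and rules alike are ordered pairs of terms. *)
Definition eqsys := set (T * T).

Definition is_trs (R : eqsys) : Prop :=
  forall l r, R (l, r) -> (forall x, l <> Var F x) /\ vars r `<=` vars l.

(* A context is given by a term s together with one of its positions p. *)
Definition rstep (X : eqsys) (s t : T) : Prop :=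
  exists (l r : T) (p : position) (sigma : V -> T),
    [/\ X (l, r), subterm_at s p = Some (subst sigma l)
      & t = replace_at s p (subst sigma r)].

Definition rsteps (X : eqsys) : T -> T -> Prop := clos_refl_trans T (rstep X).

Definition sym_step (X : eqsys) (s t : T) : Prop := rstep X s t \/ rstep X t s.

Definition conversion (X : eqsys) : T -> T -> Prop :=
  clos_refl_trans T (sym_step X).

Definition joinable (X : eqsys) (s t : T) : Prop :=
  exists2 u, rsteps X s u & rsteps X t u.

Definition normal_form (X : eqsys) (t : T) : Prop := forall u, ~ rstep X t u.

Definition terminating (X : eqsys) : Prop :=
  ~ exists u : nat -> T, forall n, rstep X (u n) (u n.+1).

Definition confluent (X : eqsys) : Prop :=
  forall s t u, rsteps X s t -> rsteps X s u -> joinable X t u.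

Definition complete (R : eqsys) : Prop := terminating R /\ confluent R.

Definition complete_presentation (R E : eqsys) : Prop :=
  [/\ is_trs R, complete R
    & forall s t, conversion R s t <-> conversion E s t].

Record reduction_order (gt : T -> T -> Prop) : Prop := ReductionOrder {
  red_irrefl : forall t, ~ gt t t;
  red_trans : forall s t u, gt s t -> gt t u -> gt s u;
  red_wf : well_founded (fun t s => gt s t);
  red_ctx : forall s t u p, is_position u p -> gt s t ->
    gt (replace_at u p s) (replace_at u p t);
  red_subst : forall s t sigma, gt s t -> gt (subst sigma s) (subst sigma t)
}.

Definition variant (rho1 rho2 : T * T) : Prop :=
  exists2 pi : V -> V, bijective pi &
    rho2 = (subst (fun x => Var F (pi x)) rho1.1,
            subst (fun x => Var F (pi x)) rho1.2).

Definition rule_vars (rho : T * T) : set V := vars rho.1 `|` vars rho.2.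

Definition unifier (sigma : V -> T) (s t : T) : Prop :=
  subst sigma s = subst sigma t.

Definition unifiable (s t : T) : Prop := exists sigma, unifier sigma s t.

Definition mgu (sigma : V -> T) (s t : T) : Prop :=
  unifier sigma s t /\
  forall tau, unifier tau s t ->
    exists delta : V -> T, forall x, tau x = subst delta (sigma x).

Record overlap (R : eqsys) (rho1 : T * T) (p : position) (rho2 : T * T)
    (u : T) : Prop := Overlap {
  overlap_rule1 : exists2 rho, R rho & variant rho rho1;
  overlap_rule2 : exists2 rho, R rho & variant rho rho2;
  overlap_disj : rule_vars rho1 `&` rule_vars rho2 = set0;
  overlap_pos : subterm_at rho2.1 p = Some u;
  overlap_nvar : forall x, u <> Var F x;
  overlap_unif : unifiable rho1.1 u;
  overlap_root : p = [::] -> ~ variant rho1 rho2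
}.

(* The critical pairs are collected over all most general unifiers; these
   agree up to renaming. *)
Definition PCP (R : eqsys) : eqsys :=
  [set st | exists l1 r1 p l2 r2 u sigma,
    [/\ overlap R (l1, r1) p (l2, r2) u,
        mgu sigma l1 u,
        (forall v q w, subterm_at (subst sigma l2) p = Some v ->
           q <> [::] -> subterm_at v q = Some w -> normal_form R w)
      & st = (replace_at (subst sigma l2) p (subst sigma r1),
              subst sigma r2)]].

(* A disjoint union X (+) {a} is rendered by the side condition ~ X a. *)
Inductive kb_step (gt : T -> T -> Prop) :
  eqsys * eqsys -> eqsys * eqsys -> Prop :=
| kb_deduce (E R : eqsys) (s t u : T) :
    rstep R u s -> rstep R u t ->
    kb_step gt (E, R) (E `|` [set (s, t)], R)
| kb_orient_l (E R : eqsys) (s t : T) :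
    ~ E (s, t) -> gt s t ->
    kb_step gt (E `|` [set (s, t)], R) (E, R `|` [set (s, t)])
| kb_orient_r (E R : eqsys) (s t : T) :
    ~ E (s, t) -> gt t s ->
    kb_step gt (E `|` [set (s, t)], R) (E, R `|` [set (t, s)])
| kb_delete (E R : eqsys) (s : T) :
    ~ E (s, s) ->
    kb_step gt (E `|` [set (s, s)], R) (E, R)
| kb_compose (E R : eqsys) (s t u : T) :
    ~ R (s, t) -> rstep R t u ->
    kb_step gt (E, R `|` [set (s, t)]) (E, R `|` [set (s, u)])
| kb_simplify_l (E R : eqsys) (s t u : T) :
    ~ E (s, t) -> rstep R s u ->
    kb_step gt (E `|` [set (s, t)], R) (E `|` [set (u, t)], R)
| kb_simplify_r (E R : eqsys) (s t u : T) :
    ~ E (s, t) -> rstep R t u ->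
    kb_step gt (E `|` [set (s, t)], R) (E `|` [set (s, u)], R)
| kb_collapse (E R : eqsys) (t s u : T) :
    ~ R (t, s) -> rstep R t u ->
    kb_step gt (E, R `|` [set (t, s)]) (E `|` [set (u, s)], R).

(* Only the values of the sequences Es and Rs at 0, ..., n matter. *)
Definition finite_run (gt : T -> T -> Prop) (E : eqsys) (n : nat)
    (Es Rs : nat -> eqsys) : Prop :=
  [/\ Es 0 = E, Rs 0 = set0
    & forall i, i < n -> kb_step gt (Es i, Rs i) (Es i.+1, Rs i.+1)].

Definition fair (n : nat) (Es Rs : nat -> eqsys) : Prop :=
  Es n = set0 /\
  forall s t, PCP (Rs n) (s, t) ->
    joinable (Rs n) s t \/ exists2 i, i <= n & sym_step (Es i) s t.

End Terms.

Arguments eqsys : clear implicits.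

(* Main.v *)
(** A step of the run turns every equation or rule [(a, b)] into a conversion
whose terms are bounded by [a] or by [b]. Hence, for every set of terms closed
under [>], a conversion of the i-th system inside that set yields a conversion
of [R_n] inside it. By fairness the two sides of an instance of a prime critical
pair are therefore connected in [R_n] below any term that is larger than both.
A peak whose inner redex has a reducible proper subterm is reduced to two
prime peaks, so all local peaks are connected below their source, which by the
criterion of Winkler and Buchberger gives confluence. *)

From Stdlib Require Import Relation_Operators.
Require Import Defs.
From mathcomp Require Import all_boot.
From mathcomp Require Import boolp classical_sets functions cardinality.

Set Implicit Arguments.
Unset Strict Implicit.
Unset Printing Implicit Defensive.

Local Open Scope classical_set_scope.

Lemma clos_rt_map (A B : Type) (f : A -> B) (R : A -> A -> Prop)
    (R' : B -> B -> Prop) :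
  (forall x y, R x y -> R' (f x) (f y)) ->
  forall x y, clos_refl_trans A R x y -> clos_refl_trans B R' (f x) (f y).
Proof.
move=> RR' x y; elim=> {x y} [x y /RR'|x|x y z _ + _].
- exact: rt_step.
- exact: rt_refl.
- exact: rt_trans.
Qed.

Lemma clos_rt_sym (A : Type) (R : A -> A -> Prop) :
  (forall x y, R x y -> R y x) ->
  forall x y, clos_refl_trans A R x y -> clos_refl_trans A R y x.
Proof.
move=> Rsym x y; elim=> {x y} [x y /Rsym|x|x y z _ + _ zy].
- exact: rt_step.
- exact: rt_refl.
- exact: rt_trans.
Qed.

Section Terms.
Context {F : signature} {V : Type}.
Local Notation T := (term F V).
Implicit Types (s t u v w l r : T) (p q : position) (sigma tau : V -> T)
  (X E R : eqsys F V) (D : T -> Prop).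

(** * Terms, positions and substitutions *)

Lemma term_induction (P : T -> Prop) :
  (forall x, P (Var F x)) ->
  (forall f (ts : {ffun 'I_(arity f) -> T}),
     (forall i, P (ts i)) -> P (App ts)) ->
  forall t, P t.
Proof.
move=> PV PA; fix IH 1 => -[x|f ts]; first exact: PV.
by apply: PA => i; apply: IH.
Qed.

Lemma subterm_at_arg f (ts : {ffun 'I_(arity f) -> T}) (i : 'I_(arity f)) q :
  subterm_at (App ts) (val i :: q) = subterm_at (ts i) q.
Proof. by rewrite /= valK. Qed.

Lemma subterm_at_cons t (k : nat) q v :
  subterm_at t (k :: q) = Some v ->
  exists f (ts : {ffun 'I_(arity f) -> T}) (i : 'I_(arity f)),
    [/\ t = App ts, k = val i & subterm_at (ts i) q = Some v].
Proof.
case: t => [//|f ts] /=; case: insubP => // i _ ik ti.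
by exists f, ts, i.
Qed.

(** Reading off the argument at each position avoids the equality of dependent pairs that the
    constructor would give. *)
Lemma App_inj f (ts us : {ffun 'I_(arity f) -> T}) : App ts = App us -> ts = us.
Proof.
move=> e; apply/ffunP => i.
have := congr1 (fun t => subterm_at t [:: val i]) e.
by rewrite !subterm_at_arg => -[].
Qed.

Lemma subterm_at_cat t p q :
  subterm_at t (p ++ q) = obind (fun v => subterm_at v q) (subterm_at t p).
Proof.
elim: p t => [//|k p IH] [//|f ts] /=.
by case: insubP.
Qed.

Lemma replace_at_cat t p q v w : subterm_at t p = Some v ->
  replace_at t (p ++ q) w = replace_at t p (replace_at v q w).
Proof.
elim: p t => [t [->]//|k p IH] t /subterm_at_cons[f [ts [i [-> -> ti]]]] /=.
congr App; apply/ffunP => j; rewrite !ffunE; case: eqP => // /val_inj ->.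
exact: IH.
Qed.

Lemma subterm_at_replace t p v w : subterm_at t p = Some v ->
  subterm_at (replace_at t p w) p = Some w.
Proof.
elim: p t => [//|k p IH] t /subterm_at_cons[f [ts [i [-> -> ti]]]] /=.
by rewrite valK ffunE eqxx; apply: IH.
Qed.

Lemma replace_at_replace t p v w w' : subterm_at t p = Some v ->
  replace_at (replace_at t p w) p w' = replace_at t p w'.
Proof.
elim: p t => [//|k p IH] t /subterm_at_cons[f [ts [i [-> -> ti]]]] /=.
congr App; apply/ffunP => j; rewrite !ffunE; case: eqP => // /val_inj ->.
exact: IH.
Qed.

Lemma replace_at_id t p v : subterm_at t p = Some v -> replace_at t p v = t.
Proof.
elim: p t => [t [->]//|k p IH] t /subterm_at_cons[f [ts [i [-> -> ti]]]] /=.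
congr App; apply/ffunP => j; rewrite !ffunE; case: eqP => // /val_inj ->.
exact: IH.
Qed.

Lemma subterm_at_replace_par t i j p q w : i != j ->
  subterm_at (replace_at t (i :: p) w) (j :: q) = subterm_at t (j :: q).
Proof.
move=> ij; case: t => [//|f ts] /=; case: insubP => // a _ aj.
by rewrite ffunE aj eq_sym (negPf ij).
Qed.

Lemma replace_at_par t i j p q w w' : i != j ->
  replace_at (replace_at t (i :: p) w) (j :: q) w'
  = replace_at (replace_at t (j :: q) w') (i :: p) w.
Proof.
move=> ij; case: t => [//|f ts] /=; congr App; apply/ffunP => a; rewrite !ffunE.
by case: (eqVneq (val a) j) => // ->; rewrite eq_sym (negPf ij).
Qed.

Lemma subterm_at_subst sigma t p v : subterm_at t p = Some v ->
  subterm_at (subst sigma t) p = Some (subst sigma v).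
Proof.
elim: p t => [t [->]//|k p IH] t /subterm_at_cons[f [ts [i [-> -> ti]]]] /=.
by rewrite valK ffunE; apply: IH.
Qed.

Lemma subst_replace_at sigma t p v w : subterm_at t p = Some v ->
  subst sigma (replace_at t p w)
  = replace_at (subst sigma t) p (subst sigma w).
Proof.
elim: p t => [//|k p IH] t /subterm_at_cons[f [ts [i [-> -> ti]]]] /=.
congr App; apply/ffunP => j; rewrite !ffunE.
by case: eqP => // /val_inj ->; apply: IH.
Qed.

Lemma subst_comp sigma tau t :
  subst tau (subst sigma t) = subst (fun x => subst tau (sigma x)) t.
Proof.
elim/term_induction: t => [//|f ts IH] /=.
by congr App; apply/ffunP => i; rewrite !ffunE.
Qed.

Lemma subst_Var t : subst (@Var F V) t = t.
Proof.
elim/term_induction: t => [//|f ts IH] /=.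
by congr App; apply/ffunP => i; rewrite !ffunE.
Qed.

Lemma eq_in_subst sigma tau t : (forall x, vars t x -> sigma x = tau x) ->
  subst sigma t = subst tau t.
Proof.
elim/term_induction: t => [x|f ts IH] /= e; first exact: e.
congr App; apply/ffunP => i; rewrite !ffunE; apply: IH => x xi.
by apply: e; exists i.
Qed.

Lemma subst_eq_in sigma tau t : subst sigma t = subst tau t ->
  forall x, vars t x -> sigma x = tau x.
Proof.
elim/term_induction: t => [x|f ts IH] /= e y; first by move=> /= ->.
by case=> i; apply: IH; move/App_inj/ffunP/(_ i): e; rewrite !ffunE.
Qed.

Lemma vars_subterm_at t x :
  vars t x -> exists p, subterm_at t p = Some (Var F x).
Proof.
elim/term_induction: t => [y /= ->|f ts IH [i /IH[p ip]]]; first by exists [::].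
by exists (val i :: p); rewrite subterm_at_arg.
Qed.

(** Later separates critical overlaps (first case) from variable overlaps (second case). *)
Lemma subterm_at_subst_inv sigma t p v :
  subterm_at (subst sigma t) p = Some v ->
  (exists u, [/\ subterm_at t p = Some u, (forall x, u <> Var F x)
     & v = subst sigma u]) \/
  (exists p1 p2 x, [/\ p = p1 ++ p2, subterm_at t p1 = Some (Var F x)
     & subterm_at (sigma x) p2 = Some v]).
Proof.
elim: p t => [|k p IH] [x|f ts] /=.
- by move=> [<-]; right; exists [::], [::], x.
- by move=> [<-]; left; exists (App ts).
- by move=> xv; right; exists [::], (k :: p), x.
case: insubP => // i _ ik; rewrite ffunE => /IH[[u [iu uV ->]]|].
  by left; exists u.
case=> p1 [p2 [x [-> ix xv]]]; right; exists (k :: p1), p2, x; split=> //=.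
by rewrite -ik valK.
Qed.

(** * Closure properties of rewriting *)

Lemma rstep_replace X c p v s t : subterm_at c p = Some v ->
  rstep X s t -> rstep X (replace_at c p s) (replace_at c p t).
Proof.
move=> cp [l [r [q [sigma [Xlr sl ->]]]]].
exists l, r, (p ++ q), sigma; split=> //.
  by rewrite subterm_at_cat (subterm_at_replace _ cp).
by rewrite (replace_at_cat _ _ (subterm_at_replace _ cp))
     (replace_at_replace _ _ cp).
Qed.

Lemma rstep_subst X sigma s t :
  rstep X s t -> rstep X (subst sigma s) (subst sigma t).
Proof.
move=> [l [r [q [tau [Xlr sl ->]]]]].
exists l, r, q, (fun x => subst sigma (tau x)); split=> //.
  by rewrite (subterm_at_subst _ sl) subst_comp.
by rewrite (subst_replace_at _ _ sl) subst_comp.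
Qed.

Lemma rstep_sub X X' s t : X `<=` X' -> rstep X s t -> rstep X' s t.
Proof.
by move=> XX' [l [r [p [sigma [/XX' ? ? ?]]]]]; exists l, r, p, sigma.
Qed.

Lemma rstep_rule X l r : X (l, r) -> rstep X l r.
Proof. by move=> Xlr; exists l, r, [::], (@Var F V); rewrite /= !subst_Var. Qed.

Lemma rstep_root X l r sigma :
  X (l, r) -> rstep X (subst sigma l) (subst sigma r).
Proof. by move=> /rstep_rule /rstep_subst. Qed.

Lemma sym_step_replace X c p v s t : subterm_at c p = Some v ->
  sym_step X s t -> sym_step X (replace_at c p s) (replace_at c p t).
Proof. by move=> cp [] /(rstep_replace cp); [left|right]. Qed.

Lemma sym_step_subst X sigma s t :
  sym_step X s t -> sym_step X (subst sigma s) (subst sigma t).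
Proof. by move=> [] /(@rstep_subst _ sigma); [left|right]. Qed.

Lemma sym_step_sub X X' s t : X `<=` X' -> sym_step X s t -> sym_step X' s t.
Proof. by move=> XX' [] /(rstep_sub XX'); [left|right]. Qed.

Lemma rsteps_replace X c p v s t : subterm_at c p = Some v ->
  rsteps X s t -> rsteps X (replace_at c p s) (replace_at c p t).
Proof.
by move=> cp; apply: clos_rt_map => {}s {}t; apply: rstep_replace cp.
Qed.

Lemma rsteps_subst X sigma s t :
  rsteps X s t -> rsteps X (subst sigma s) (subst sigma t).
Proof. by apply: clos_rt_map => {}s {}t; apply: rstep_subst. Qed.

Lemma rsteps_App X f (ts us : {ffun 'I_(arity f) -> T}) :
  (forall i, rsteps X (ts i) (us i)) -> rsteps X (App ts) (App us).
Proof.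
move=> tu.
(* In [h k] the first [k] arguments are already rewritten, so [h k] and [h k.+1] differ at argument
   [k] only. *)
pose h k := App [ffun i : 'I_(arity f) => if i < k then us i else ts i].
have h0 : h 0 = App ts by congr App; apply/ffunP => i; rewrite ffunE.
have hn : h (arity f) = App us.
  by congr App; apply/ffunP => i; rewrite ffunE ltn_ord.
suff h0k k : k <= arity f -> rsteps X (h 0) (h k).
  by rewrite -h0 -hn; apply: h0k.
elim: k => [|k IH] kn; first exact: rt_refl.
apply: rt_trans (IH (ltnW kn)) _.
pose i := Ordinal kn.
have hi : subterm_at (h k) [:: val i] = Some (ts i).
  by rewrite subterm_at_arg ffunE ltnn.
have -> : h k.+1 = replace_at (h k) [:: val i] (us i).
  congr App; apply/ffunP => j; rewrite !ffunE /= ltnS leq_eqVlt.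
  by case: eqP => [e|//]; congr (us _); apply: val_inj.
rewrite -{1}(replace_at_id hi); exact: rsteps_replace hi (tu i).
Qed.

Lemma rsteps_subst_pointwise X sigma tau t :
  (forall x, rsteps X (sigma x) (tau x)) ->
  rsteps X (subst sigma t) (subst tau t).
Proof.
move=> st; elim/term_induction: t => [x|f ts IH] /=; first exact: st.
by apply: rsteps_App => i; rewrite !ffunE.
Qed.

(* Composing transpositions moves the elements of a finite set one by one. *)
Lemma fresh_renaming (A B : set V) : infinite_set [set: V] ->
  finite_set A -> finite_set B ->
  exists2 pi : V -> V, bijective pi & forall x, A x -> ~ B (pi x).
Proof.
move=> V_infinite finA finB.
have [xs ->] := (finite_seqP (T := {classic V}) A).1 finA.
elim: xs => [|x xs [pi pi_bij piB]]; first by exists id; [exists id|].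
have finC : finite_set (B `|` pi @` [set` xs]).
  by rewrite finite_setU; split=> //; apply/finite_image/finite_seqP; exists xs.
have [y [_ yC]] := infinite_setN0 (infinite_setD V_infinite finC).
(* Since [y] lies outside [B] and outside the images of [xs], exchanging [pi x] and [y] mends [x];
   an image of [xs] is either kept or, if it equals [pi x], sent to [y]. *)
pose swap (z : {classic V}) : {classic V} :=
  if z == pi x then y else if z == y then pi x else z.
have swapK : involutive swap.
  move=> z; rewrite /swap; case: (eqVneq z (pi x)) => [->|zx].
    by rewrite eqxx; case: eqP.
  by case: (eqVneq z y) => [->|zy]; rewrite ?eqxx // (negPf zx) (negPf zy).
exists (swap \o pi); first by apply: bij_comp => //; exists swap.
move=> z; rewrite /= inE => /predU1P[->|zxs]; rewrite /swap.
  by rewrite eqxx => By; apply: yC; left.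
case: eqP => [_ By|_]; first by apply: yC; left.
case: eqP => [zy|_]; last exact: piB.
by case: yC; right; exists z.
Qed.

Definition update sigma (x : V) t : V -> T :=
  fun y => if pselect (y = x) then t else sigma y.

Lemma update_same sigma x t : update sigma x t x = t.
Proof. by rewrite /update; case: pselect. Qed.

Lemma update_other sigma x t y : y <> x -> update sigma x t y = sigma y.
Proof. by rewrite /update; case: pselect. Qed.

(** The variable [x] may occur in [t] several times: the left term has changed one copy of [sigma x]
    only, and the remaining copies catch up. *)
Lemma rsteps_replace_var X sigma t p q x w :
  subterm_at t p = Some (Var F x) ->
  rsteps X (sigma x) (replace_at (sigma x) q w) ->
  rsteps X (replace_at (subst sigma t) (p ++ q) w)
    (subst (update sigma x (replace_at (sigma x) q w)) t).
Proof.
move=> tp xw; elim: p t tp => [t [->]|k p IH t].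
  by rewrite /= update_same; apply: rt_refl.
move=> /subterm_at_cons[f [ts [i [-> -> ti]]]] /=.
apply: rsteps_App => j; rewrite !ffunE.
case: eqP => [/val_inj ->|_]; first exact: IH.
apply: rsteps_subst_pointwise => y.
case: (pselect (y = x)) => [->|yx]; first by rewrite update_same.
by rewrite update_other //; apply: rt_refl.
Qed.

(** * Most general unifiers *)

Fixpoint term_size t : nat :=
  match t with
  | Var _ => 1
  | App f ts => (\sum_(i < arity f) term_size (ts i)).+1
  end.

Lemma term_size_gt0 t : 0 < term_size t.
Proof. by case: t. Qed.

Lemma term_size_subterm_at t p v :
  p <> [::] -> subterm_at t p = Some v -> term_size v < term_size t.
Proof.
elim: p t => [//|k p IH] t _ /subterm_at_cons[f [ts [i [-> _ tp]]]] /=.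
rewrite ltnS (bigD1 i) //=; apply: leq_trans (leq_addr _ _).
by case: p IH tp => [_ [->]//|k' p IH tp]; apply/ltnW/IH.
Qed.

(** The equality case serves as occurs check: if [x] occurs properly in [t], the two instances
    differ in size and cannot be equal. *)
Lemma term_size_subst_var sigma t x : vars t x ->
  term_size (sigma x) <= term_size (subst sigma t) ?= iff `[< t = Var F x >].
Proof.
elim/term_induction: t => [y /= ->|f ts IH].
  by apply/leqifP; rewrite asboolT.
move=> [i /IH ix]; rewrite asboolF //=; apply/leqifP.
rewrite ltnS (bigD1 i) //= ffunE.
exact: leq_trans ix.1 (leq_addr _ _).
Qed.

Implicit Types es : seq (T * T).

Fixpoint unifies sigma es : Prop :=
  if es is e :: es' then unifier sigma e.1 e.2 /\ unifies sigma es' else True.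

Lemma unifies_cat sigma es es' :
  unifies sigma (es ++ es') <-> unifies sigma es /\ unifies sigma es'.
Proof. by elim: es => [|e es IH] /=; [tauto|rewrite IH; tauto]. Qed.

Lemma unifies_map (I : eqType) sigma (g : I -> T * T) (s : seq I) :
  unifies sigma [seq g i | i <- s] <->
  (forall i, i \in s -> unifier sigma (g i).1 (g i).2).
Proof.
elim: s => [|i s IH] //=; rewrite IH; split=> [[gi gs] j|gs].
  by rewrite inE => /predU1P[->//|/gs].
by split=> [|j js]; apply: gs; rewrite inE ?eqxx ?js ?orbT.
Qed.

Lemma unifies_subst sigma tau es :
  unifies sigma [seq (subst tau e.1, subst tau e.2) | e <- es] <->
  unifies (fun x => subst sigma (tau x)) es.
Proof. by elim: es => //= e es ->; rewrite /unifier /= !subst_comp. Qed.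

Lemma eq_unifies sigma tau es :
  sigma =1 tau -> unifies sigma es -> unifies tau es.
Proof. by move=> /funext ->. Qed.

Definition list_mgu sigma es : Prop :=
  unifies sigma es /\
  forall tau, unifies tau es ->
    exists delta : V -> T, forall x, tau x = subst delta (sigma x).

Lemma subst_update_Var tau x t s : tau x = subst tau t ->
  subst tau (subst (update (@Var F V) x t) s) = subst tau s.
Proof.
move=> xt; rewrite subst_comp; congr subst; apply: funext => y.
case: (pselect (y = x)) => [->|yx]; first by rewrite update_same.
by rewrite update_other.
Qed.

(** Variable elimination. As [x] does not occur in [t], [theta] fixes [t] and so identifies [x] with
    [t]; conversely every unifier [tau] of the list absorbs [theta], hence solves the reduced list
    and factors through [sigma]. *)
Lemma list_mgu_elim x t es sigma : ~ vars t x ->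
  list_mgu sigma [seq (subst (update (@Var F V) x t) e.1,
                       subst (update (@Var F V) x t) e.2) | e <- es] ->
  list_mgu (fun y => subst sigma (update (@Var F V) x t y))
    ((Var F x, t) :: es).
Proof.
set theta := update _ _ _ => xt [/unifies_subst sigma_es sigma_min]; split.
  split=> //=; rewrite /unifier /= -subst_comp; congr subst.
  rewrite /theta update_same -[LHS]subst_Var; apply: eq_in_subst => y yt.
  by rewrite update_other // => yx; apply: xt; rewrite -yx.
move=> tau /= [xtau tau_es].
have e y : tau y = subst tau (theta y).
  by rewrite (subst_update_Var (Var F y)).
have [|delta tauE] := sigma_min tau.
  by apply/unifies_subst; apply: eq_unifies tau_es.
exists delta => y; rewrite subst_comp e; congr subst.
exact: funext.
Qed.

(* Variable elimination leaves the instances under a fixed unifier [tau]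
   unchanged, so their total size decreases at every step. *)
Lemma list_mgu_exists tau es :
  unifies tau es -> exists sigma, list_mgu sigma es.
Proof.
(* Only left-hand sides are counted, since [tau] makes the two sides of every equation equal. *)
pose m es := \sum_(e <- es) term_size (subst tau e.1).
elim: (m es).+1 {-2}es (ltnSn (m es)) => // {es}n IH [_ _|[s t] es].
  exists (@Var F V); split=> // tau' _; exists tau' => x //.
rewrite ltnS /m big_cons -/(m es) => mn [/= st tau_es].
have elim_var x u : tau x = subst tau u -> u <> Var F x -> m es < n ->
    exists sigma, list_mgu sigma ((Var F x, u) :: es).
  move=> xu ux esn.
  have xNu : ~ vars u x.
    move=> /(term_size_subst_var tau)/ltn_leqif.
    by rewrite -xu ltnn asboolF.
  pose th := update (@Var F V) x u.
  have [|/=|sigma sigmaP] := IH [seq (subst th e.1, subst th e.2) | e <- es].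
  - rewrite /m big_map /=; under eq_bigr do rewrite subst_update_Var //.
    exact: esn.
  - apply/unifies_subst; apply: eq_unifies tau_es => y.
    by rewrite (subst_update_Var (Var F y)).
  - by eexists; apply: list_mgu_elim sigmaP.
have esn : m es < n.
  by apply: leq_trans mn; rewrite -add1n leq_add2r term_size_gt0.
case: (pselect (s = t)) => [<-|sNt].
  have [sigma [sigma_es sigma_min]] := IH _ esn tau_es.
  by exists sigma; split=> // tau' [_ /sigma_min].
case: s t st sNt mn => [x|f ts] [y|g us] st sNt mn.
- by apply: elim_var => // e; apply: sNt.
- by apply: elim_var => // e; apply: sNt.
- have [|//||sigma [[sx sigma_es] sigma_min]] := elim_var y (App ts) => //.
  exists sigma; split=> [|tau' [tx tau'_es]]; first by split.
  by apply: sigma_min; split.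
have fg : f = g by case: st.
case: g / fg us st sNt mn => us st sNt mn.
pose args := [seq (ts i, us i) | i <- enum 'I_(arity f)].
have dec tau' : unifies tau' ((App ts, App us) :: es) <->
    unifies tau' (args ++ es).
  rewrite unifies_cat unifies_map /=; split=> -[tu ?]; split=> //.
    by move=> i _; move/App_inj/ffunP/(_ i): tu; rewrite !ffunE.
  rewrite /unifier /=; congr App; apply/ffunP => i; rewrite !ffunE.
  by apply: tu; rewrite mem_enum.
have [||sigma [/dec sigma_es sigma_min]] := IH (args ++ es).
(* Decomposition drops the root symbol, which contributes one to the measure. *)
- apply: leq_trans mn.
  rewrite /m big_cat big_map big_enum /= addSn ltnS leq_add2r.
  by under [leqRHS]eq_bigr do rewrite ffunE.
- by apply/dec.
by exists sigma; split=> // tau' /dec /sigma_min.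
Qed.

(** * Conversions confined to a set of terms *)

Definition oriented (gt : T -> T -> Prop) X : Prop :=
  forall l r, X (l, r) -> gt l r.

(** An empty conversion puts no condition on its only term. *)
Definition conv_in D X : T -> T -> Prop :=
  clos_refl_trans T (fun s t => [/\ D s, D t & sym_step X s t]).

Lemma sym_step_sym X s t : sym_step X s t -> sym_step X t s.
Proof. by case; [right|left]. Qed.

Lemma conv_in_sym D X s t : conv_in D X s t -> conv_in D X t s.
Proof. by apply: clos_rt_sym => {}s {}t [? ? /sym_step_sym]. Qed.

Lemma conv_in_step D X s t : D s -> D t -> rstep X s t -> conv_in D X s t.
Proof. by move=> Ds Dt st; apply: rt_step; split=> //; left. Qed.

Lemma conversion_step X s t : rstep X s t -> conversion X s t.
Proof. by move=> st; apply: rt_step; left. Qed.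

Lemma conversion_sym X s t : conversion X s t -> conversion X t s.
Proof. by apply: clos_rt_sym => {}s {}t /sym_step_sym. Qed.

Lemma conv_in_conversion D X s t : conv_in D X s t -> conversion X s t.
Proof. by apply: (clos_rt_map (f := id)) => {}s {}t []. Qed.

Lemma conversion_conv_in X s t :
  conversion X s t -> conv_in (fun _ => True) X s t.
Proof. exact: (clos_rt_map (f := id)). Qed.

Lemma conv_in_replace D D' X c p v s t : subterm_at c p = Some v ->
  (forall w, D w -> D' (replace_at c p w)) ->
  conv_in D X s t -> conv_in D' X (replace_at c p s) (replace_at c p t).
Proof.
move=> cp DD'; apply: clos_rt_map => {}s {}t [/DD' ? /DD' ? st].
by split=> //; apply: sym_step_replace cp st.
Qed.

Lemma conv_in_subst D D' X sigma s t :
  (forall w, D w -> D' (subst sigma w)) ->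
  conv_in D X s t -> conv_in D' X (subst sigma s) (subst sigma t).
Proof.
move=> DD'; apply: clos_rt_map => {}s {}t [/DD' ? /DD' ? st].
by split=> //; apply: sym_step_subst.
Qed.

Lemma conversion_pairs X X' :
  (forall a b, X (a, b) -> conversion X' a b) ->
  forall s t, conversion X s t -> conversion X' s t.
Proof.
move=> XX'.
have step s t : rstep X s t -> conversion X' s t.
  move=> [l [r [p [sigma [/XX'/conversion_conv_in lr sp ->]]]]].
  rewrite -{1}(replace_at_id sp); apply: (@conv_in_conversion (fun _ => True)).
  apply: (conv_in_replace (D := fun _ => True) sp) => //.
  exact: (conv_in_subst (D := fun _ => True) _ lr).
move=> s t; elim=> {s t} [s t [/step|/step/conversion_sym]|s|s t u _ + _] //.
  exact: rt_refl.
exact: rt_trans.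
Qed.

(** * Consequences of a reduction order *)

Section Order.
Context (gt : T -> T -> Prop) (gt_red : reduction_order gt).

Lemma gt_replace c p v s t : subterm_at c p = Some v ->
  gt s t -> gt (replace_at c p s) (replace_at c p t).
Proof. by move=> cp; apply: red_ctx; first exact: gt_red; exists v. Qed.

Lemma gt_replaceE c p s t : subterm_at c p = Some s ->
  gt s t -> gt c (replace_at c p t).
Proof. by move=> cp /(gt_replace cp); rewrite (replace_at_id cp). Qed.

Lemma rstep_gt X s t : oriented gt X -> rstep X s t -> gt s t.
Proof.
move=> gtX [l [r [p [sigma [/gtX lr sp ->]]]]].
by apply: gt_replaceE sp _; apply: red_subst.
Qed.

(* Iterating the context [t[]_p] on [s > t] would give an infinite descent. *)
Lemma gt_not_subterm s t p : gt s t -> subterm_at t p = Some s -> False.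
Proof.
move: t; elim/(well_founded_ind (red_wf gt_red)): s => s IH t st tp.
apply: (IH t st (replace_at t p t)); first exact: gt_replaceE tp st.
exact: subterm_at_replace tp.
Qed.

(** If [l] is a variable, either it occurs in [r], so that [l] is a subterm of a smaller term, or
    substituting [r] for it yields [gt r r]. If a variable of [r] is missing from [l], substituting
    [l] for it fixes [l] and makes [l] a subterm of the smaller instance of [r]. *)
Lemma oriented_is_trs X : oriented gt X -> is_trs X.
Proof.
move=> gtX l r /gtX lr; split=> [x lx|y yr].
  rewrite {}lx in lr; case: (pselect (vars r x)) => [/vars_subterm_at[p]|xr].
    exact: gt_not_subterm.
  apply: (red_irrefl gt_red (t := r)).
  have := red_subst gt_red (update (@Var F V) x r) lr.
  rewrite /= update_same -[X in gt r X]subst_Var; congr gt.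
  rewrite !subst_Var -[RHS]subst_Var; apply: eq_in_subst => y yr.
  by rewrite update_other // => yx; apply: xr; rewrite -yx.
apply: contrapT => yl.
have [p rp] := vars_subterm_at yr.
have := red_subst gt_red (update (@Var F V) y l) lr.
have -> : subst (update (@Var F V) y l) l = l.
  rewrite -[RHS]subst_Var; apply: eq_in_subst => x xl.
  by rewrite update_other // => xy; apply: yl; rewrite -xy.
move=> lr'; apply: (gt_not_subterm (p := p) lr').
rewrite (subterm_at_subst _ rp) /=.
by rewrite update_same.
Qed.

Lemma oriented_terminating X : oriented gt X -> terminating X.
Proof.
move=> gtX [f fS].
suff noinf s : forall k, f k <> s by exact: noinf (erefl (f 0)).
elim/(well_founded_ind (red_wf gt_red)): s => s IH k fk.
by apply: (IH (f k.+1) _ k.+1) => //; rewrite -fk; apply: rstep_gt (fS k).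
Qed.

(** Not an interval, but the union of the down-sets of [a] and of [b]. *)
Definition between a b v : Prop :=
  (v = a \/ gt a v) \/ (v = b \/ gt b v).

Lemma between_replace c p v0 a b v : subterm_at c p = Some v0 ->
  between a b v ->
  between (replace_at c p a) (replace_at c p b) (replace_at c p v).
Proof.
move=> cp [[->|/(gt_replace cp)]|[->|/(gt_replace cp)]].
- by left; left.
- by left; right.
- by right; left.
- by right; right.
Qed.

Lemma between_subst sigma a b v : between a b v ->
  between (subst sigma a) (subst sigma b) (subst sigma v).
Proof.
move=> [[->|/(red_subst gt_red sigma)]|[->|/(red_subst gt_red sigma)]].
- by left; left.
- by left; right.
- by right; left.
- by right; right.
Qed.

Lemma between_l a b : between a b a. Proof. by left; left. Qed.

Lemma between_r a b : between a b b. Proof. by right; left. Qed.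

Lemma conv_in_rule X a b : X (a, b) -> conv_in (between a b) X a b.
Proof.
by move=> /rstep_rule; apply: conv_in_step; [exact: between_l|exact: between_r].
Qed.

Lemma conv_in_rule_rev X a b : X (b, a) -> conv_in (between a b) X a b.
Proof.
move=> /rstep_rule ba; apply: conv_in_sym.
by apply: conv_in_step ba; [exact: between_r|exact: between_l].
Qed.

Lemma conv_in_rule_stepl X a b c : rstep X a c -> gt a c -> X (c, b) ->
  conv_in (between a b) X a b.
Proof.
move=> ac gtac /rstep_rule cb.
have Dc : between a b c by left; right.
apply: (rt_trans _ _ _ c); apply: conv_in_step => //.
  exact: between_l.
exact: between_r.
Qed.

Lemma conv_in_rule_stepr X a b c : rstep X b c -> gt b c -> X (a, c) ->
  conv_in (between a b) X a b.
Proof.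
move=> bc gtbc /rstep_rule ac.
have Dc : between a b c by right; right.
apply: (rt_trans _ _ _ c); first by apply: conv_in_step => //; apply: between_l.
by apply: conv_in_sym; apply: conv_in_step => //; apply: between_r.
Qed.

(** * Inference steps as conversions *)

Lemma kb_step_oriented S S' :
  kb_step gt S S' -> oriented gt S.2 -> oriented gt S'.2.
Proof.
case=> {S S'} //= E R.
- by move=> s t _ st gtR l r [/gtR|[-> ->]].
- by move=> s t _ st gtR l r [/gtR|[-> ->]].
- move=> s t u _ tu gtR l r [|[-> ->]]; first by move=> Rlr; apply: gtR; left.
  apply: (red_trans gt_red (t := t)); first by apply: gtR; right.
  by apply: rstep_gt tu => ? ? ?; apply: gtR; left.
- by move=> t s u _ _ gtR l r Rlr; apply: gtR; left.
Qed.

(** A pair that disappears is replaced by at most two steps. The middle term, if any, is a reduct of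
    one side and therefore smaller than that side, because the rules are oriented. *)
Lemma kb_step_conv_in S S' : kb_step gt S S' -> oriented gt S.2 ->
  forall a b, (S.1 `|` S.2) (a, b) ->
  conv_in (between a b) (S'.1 `|` S'.2) a b.
Proof.
case=> {S S'} /= E R.
- by move=> s t u us ut _ a b [Eab|Rab]; apply: conv_in_rule; [left; left|right].
- move=> s t _ st _ a b [[Eab|[-> ->]]|Rab]; apply: conv_in_rule.
  + by left.
  + by right; right.
  + by right; left.
- move=> s t _ st _ a b [[Eab|[-> ->]]|Rab].
  + by apply: conv_in_rule; left.
  + by apply: conv_in_rule_rev; right; right.
  + by apply: conv_in_rule; right; left.
- move=> s _ _ a b [[Eab|[-> ->]]|Rab].
  + by apply: conv_in_rule; left.
  + exact: rt_refl.
  + by apply: conv_in_rule; right.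
- move=> s t u _ tu gtR a b [Eab|[Rab|[-> ->]]].
  + by apply: conv_in_rule; left.
  + by apply: conv_in_rule; right; left.
  + apply: (@conv_in_rule_stepr _ _ _ u).
    * by apply: rstep_sub tu => x Rx; right; left.
    * by apply: rstep_gt tu => ? ? ?; apply: gtR; left.
    * by right; right.
- move=> s t u _ su gtR a b [[Eab|[-> ->]]|Rab].
  + by apply: conv_in_rule; left; left.
  + apply: (@conv_in_rule_stepl _ _ _ u).
    * by apply: rstep_sub su => x Rx; right.
    * exact: rstep_gt su.
    * by left; right.
  + by apply: conv_in_rule; right.
- move=> s t u _ tu gtR a b [[Eab|[-> ->]]|Rab].
  + by apply: conv_in_rule; left; left.
  + apply: (@conv_in_rule_stepr _ _ _ u).
    * by apply: rstep_sub tu => x Rx; right.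
    * exact: rstep_gt tu.
    * by left; right.
  + by apply: conv_in_rule; right.
- move=> t s u _ tu gtR a b [Eab|[Rab|[-> ->]]].
  + by apply: conv_in_rule; left; left.
  + by apply: conv_in_rule; right.
  + apply: (@conv_in_rule_stepl _ _ _ u).
    * by apply: rstep_sub tu => x Rx; right.
    * by apply: rstep_gt tu => ? ? ?; apply: gtR; left.
    * by left; right.
Qed.

(** Backwards no bound is claimed: a deduced equation is justified through the source of its peak,
    which lies above both sides. *)
Lemma kb_step_conversion S S' : kb_step gt S S' ->
  forall a b, (S'.1 `|` S'.2) (a, b) -> conversion (S.1 `|` S.2) a b.
Proof.
have rule X a b : X (a, b) -> conversion X a b.
  by move=> /rstep_rule/conversion_step.
have old X X' a b : X' `<=` X -> rstep X' a b -> conversion X a b.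
  by move=> X'X /(rstep_sub X'X)/conversion_step.
case=> {S S'} /= E R.
- move=> s t u us ut a b [[Eab|[-> ->]]|Rab].
  + by apply: rule; left.
  + apply: (rt_trans _ _ _ u); first apply: conversion_sym.
      by apply: old us; right.
    by apply: old ut; right.
  + by apply: rule; right.
- move=> s t _ st a b [Eab|[Rab|[-> ->]]]; apply: rule.
  + by left; left.
  + by right.
  + by left; right.
- move=> s t _ st a b [Eab|[Rab|[-> ->]]].
  + by apply: rule; left; left.
  + by apply: rule; right.
  + by apply/conversion_sym/rule; left; right.
- by move=> s _ a b [Eab|Rab]; apply: rule; [left; left|right].
- move=> s t u _ tu a b [Eab|[Rab|[-> ->]]].
  + by apply: rule; left.
  + by apply: rule; right; left.
  + apply: (rt_trans _ _ _ t); first by apply: rule; right; right.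
    by apply: old tu => x Rx; right; left.
- move=> s t u _ su a b [[Eab|[-> ->]]|Rab].
  + by apply: rule; left; left.
  + apply: (rt_trans _ _ _ s); last by apply: rule; left; right.
    by apply/conversion_sym; apply: old su => x Rx; right.
  + by apply: rule; right.
- move=> s t u _ tu a b [[Eab|[-> ->]]|Rab].
  + by apply: rule; left; left.
  + apply: (rt_trans _ _ _ t); first by apply: rule; left; right.
    by apply: old tu => x Rx; right.
  + by apply: rule; right.
- move=> t s u _ tu a b [[Eab|[-> ->]]|Rab].
  + by apply: rule; left.
  + apply: (rt_trans _ _ _ t); last by apply: rule; right; right.
    by apply/conversion_sym; apply: old tu => x Rx; right; left.
  + by apply: rule; right; left.
Qed.

(** Bounds survive contexts and substitutions, so the conversion that replaces a step stays below
    one of its two ends, hence in the down-set [D]. *)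
Lemma conv_in_pairs D X X' :
  (forall s t, D s -> gt s t -> D t) ->
  (forall a b, X (a, b) -> conv_in (between a b) X' a b) ->
  forall s t, conv_in D X s t -> conv_in D X' s t.
Proof.
move=> Ddown XX'.
have step s t : D s -> D t -> rstep X s t -> conv_in D X' s t.
  move=> Ds Dt [l [r [p [sigma [/XX' lr sp tE]]]]].
  have Dbetween w : between s t w -> D w.
    by case=> -[->|] //; apply: Ddown.
  rewrite tE -{1}(replace_at_id sp).
  apply: (conv_in_replace (D := between (subst sigma l) (subst sigma r)) sp).
    move=> w /(between_replace sp).
    by rewrite (replace_at_id sp) -tE => /Dbetween.
  by apply: conv_in_subst lr => w; apply: between_subst.
move=> s t; elim=> {s t} [s t [Ds Dt] [st|ts]|s|s t u _ + _].
- exact: step.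
- by apply/conv_in_sym/step.
- exact: rt_refl.
- exact: rt_trans.
Qed.

Lemma rsteps_conv_in X s t u : oriented gt X -> gt s t -> rsteps X t u ->
  gt s u /\ conv_in (gt s) X t u.
Proof.
move=> gtX + tu; elim: tu => {t u} [t u tu|t|t u v _ IH1 _ IH2] st.
- have su : gt s u by apply: red_trans st (rstep_gt gtX tu).
  by split=> //; apply: conv_in_step.
- by split=> //; apply: rt_refl.
- have [su tu] := IH1 st; have [sv uv] := IH2 su.
  by split=> //; apply: rt_trans tu uv.
Qed.

Lemma joinable_conv_in X s t u : oriented gt X -> gt s t -> gt s u ->
  joinable X t u -> conv_in (gt s) X t u.
Proof.
move=> gtX st su [v /(rsteps_conv_in gtX st)[_ tv]].
move=> /(rsteps_conv_in gtX su)[_ uv].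
exact: rt_trans tv (conv_in_sym uv).
Qed.

(** Well-founded induction on the source [s]: confluence at all smaller terms turns a conversion
    below [s] into a joining pair. Joining the first steps this way and then closing both sides by
    induction completes the diagram, as in the proof of Newman's lemma. *)
Lemma connected_below_confluent X : oriented gt X ->
  (forall s t u, rstep X s t -> rstep X s u -> conv_in (gt s) X t u) ->
  confluent X.
Proof.
move=> gtX peak s.
elim/(well_founded_ind (red_wf gt_red)): s => s IH t u st su.
(* The bound on [w] is carried along so that the induction hypothesis applies at the middle term of
   a composed conversion. *)
have conv_join v w : conv_in (gt s) X v w -> gt s v -> gt s w /\ joinable X v w.
  elim=> {v w} [v w [sv sw vw] _|v sv|v w x _ IH1 _ IH2 sv].
  - split=> //; case: vw => [vw|wv].
      by exists w; [apply: rt_step|apply: rt_refl].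
    by exists v; [apply: rt_refl|apply: rt_step].
  - by split=> //; exists v; apply: rt_refl.
  - have [sw [y vy wy]] := IH1 sv; have [sx [z wz xz]] := IH2 sw.
    have [y' yy' zy'] := IH w sw y z wy wz.
    by split=> //; exists y'; [apply: rt_trans yy'|apply: rt_trans zy'].
have first v w : rsteps X v w ->
    v = w \/ exists2 v', rstep X v v' & rsteps X v' w.
  elim=> {v w} [v w vw|v|v w x _ [->|[v' vv' v'w]] wx IHwx] //.
  - by right; exists w => //; apply: rt_refl.
  - by left.
  - by right; exists v' => //; apply: rt_trans v'w wx.
have [<-|[t1 st1 t1t]] := first _ _ st; first by exists u => //; apply: rt_refl.
have [<-|[u1 su1 u1u]] := first _ _ su; first by exists t => //; apply: rt_refl.
have gt_st1 : gt s t1 by apply: rstep_gt st1.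
have [gt_su1 [v t1v u1v]] := conv_join _ _ (peak _ _ _ st1 su1) gt_st1.
have [w tw vw] := IH _ gt_st1 _ _ t1t t1v.
have [x ux wx] := IH _ gt_su1 _ _ u1u (rt_trans _ _ _ _ _ u1v vw).
by exists x => //; apply: rt_trans tw wx.
Qed.

(** * Prime critical pairs and local peaks *)

Lemma finite_vars t : finite_set (vars t).
Proof.
elim/term_induction: t => [x|f ts IH] /=; first exact: finite_set1.
apply: (@sub_finite_set _ _ (\bigcup_(i in [set: 'I_(arity f)]) vars (ts i))).
  by move=> x [i xi]; exists i.
exact: bigcup_finite.
Qed.

Lemma finite_rule_vars (rho : T * T) : finite_set (rule_vars rho).
Proof. by rewrite finite_setU; split; apply: finite_vars. Qed.

Lemma vars_rename (pi : V -> V) t y :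
  vars (subst (fun x => Var F (pi x)) t) y -> exists2 x, vars t x & y = pi x.
Proof.
elim/term_induction: t => [x /= ->|f ts IH /= [i]]; first by exists x.
by rewrite ffunE => /IH[x xi ->]; exists x => //; exists i.
Qed.

(** The form in which fairness enters the analysis of peaks; [delta] is present because a peak only
    gives an instance of a critical pair. *)
Definition pairs_connected X R : Prop :=
  forall a b delta s, X (a, b) ->
  gt s (subst delta a) -> gt s (subst delta b) ->
  conv_in (gt s) R (subst delta a) (subst delta b).

Section Peaks.
Context (V_infinite : infinite_set [set: V]) (R : eqsys F V)
  (gtR : oriented gt R) (pcpR : pairs_connected (PCP R) R).

(** With the rules renamed apart, both matching substitutions merge into one unifier [tau]. It
    factors through a most general unifier as [delta], so the peak is the [delta]-instance of a
    prime critical pair. *)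
Lemma prime_overlap_connected l1 r1 l2 r2 p u sigma1 sigma2 :
  R (l1, r1) -> R (l2, r2) -> subterm_at l2 p = Some u ->
  (forall x, u <> Var F x) -> subst sigma1 l1 = subst sigma2 u ->
  (forall q w, q <> [::] -> subterm_at (subst sigma1 l1) q = Some w ->
     normal_form R w) ->
  conv_in (gt (subst sigma2 l2)) R (subst sigma2 r2)
    (replace_at (subst sigma2 l2) p (subst sigma1 r1)).
Proof.
move=> R1 R2 l2p uV l1u prime.
have [pi pi_bij pi_fresh] := fresh_renaming V_infinite
    (finite_rule_vars (l1, r1)) (finite_rule_vars (l2, r2)).
have [pi' piK pi'K] := pi_bij.
pose ren := subst (fun x => Var F (pi x)).
(* [tau] acts as [sigma2] on the second rule and undoes the renaming before [sigma1] elsewhere. *)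
pose tau x := if `[< rule_vars (l2, r2) x >] then sigma2 x else sigma1 (pi' x).
have tau2 t : vars t `<=` rule_vars (l2, r2) -> subst tau t = subst sigma2 t.
  move=> tsub; apply: eq_in_subst => x /tsub xt.
  by rewrite /tau asboolT.
have tau1 t : vars t `<=` rule_vars (l1, r1) ->
    subst tau (ren t) = subst sigma1 t.
  move=> tsub; rewrite subst_comp; apply: eq_in_subst => x /tsub/pi_fresh xt /=.
  by rewrite /tau asboolF // piK.
have tl1 : subst tau (ren l1) = subst sigma1 l1 by apply: tau1 => x; left.
have tr1 : subst tau (ren r1) = subst sigma1 r1 by apply: tau1 => x; right.
have tl2 : subst tau l2 = subst sigma2 l2 by apply: tau2 => x; left.
have tr2 : subst tau r2 = subst sigma2 r2 by apply: tau2 => x; right.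
have tu : subst tau u = subst sigma2 u.
  have := subterm_at_subst tau l2p.
  by rewrite tl2 (subterm_at_subst _ l2p) => -[].
have tau_unif : unifier tau (ren l1) u by rewrite /unifier tl1 tu.
(* A root overlap of two variants is not an overlap proper. Its two reducts coincide: the variables
   of [r1] occur in [l1], where the unified left-hand sides determine their values. *)
case: (pselect (p = [::] /\ variant (ren l1, ren r1) (l2, r2))).
  move=> [p0 [pi2 _ [l2E r2E]]]; move: l2p; rewrite p0 /= => -[l2u].
  suff <- : subst sigma1 r1 = subst sigma2 r2 by apply: rt_refl.
  rewrite -tr1 -tr2 r2E subst_comp; apply: eq_in_subst => x xr.
  have [y yr ->] := vars_rename xr.
  have yl : vars l1 y by case: (oriented_is_trs gtR R1) => _; apply.
  have := tau_unif; rewrite -l2u l2E /unifier subst_comp.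
  by rewrite !subst_comp => /subst_eq_in/(_ _ yl).
move=> not_variant.
have [|sigma [[sigma_unif _] sigma_min]] :=
    @list_mgu_exists tau [:: (ren l1, u)]; first by split.
have [|delta deltaE] := sigma_min tau; first by split.
have tauE t : subst tau t = subst delta (subst sigma t).
  by rewrite subst_comp; congr subst; apply: funext.
have l2sp := subterm_at_subst sigma l2p.
have pcp : PCP R
    (replace_at (subst sigma l2) p (subst sigma (ren r1)), subst sigma r2).
  exists (ren l1), (ren r1), p, l2, r2, u, sigma; split=> //.
  - split=> //.
    + by exists (l1, r1) => //; exists pi.
    + exists (l2, r2) => //; exists id; first by exists id.
      by rewrite /= !subst_Var.
    + apply/seteqP; split=> // x [x1 x2].
      by case: x1 => /vars_rename[y yl xE]; apply: (pi_fresh y);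
         [left| rewrite -xE|right|rewrite -xE].
    + by exists tau.
    + by move=> p0 var12; apply: not_variant.
  - by split=> // tau' tau'_unif; apply: sigma_min; split.
  (* A step from a proper subterm of the most general instance would instantiate along [delta] to a
     step that [prime] forbids. *)
  - move=> v q w; rewrite l2sp => -[<-] q0 vq w' ww'.
    apply: (prime q (subst delta w) q0) (rstep_subst delta ww').
    by rewrite -tl1 tau_unif tauE; apply: subterm_at_subst.
have s_r2 : gt (subst sigma2 l2) (subst sigma2 r2).
  by apply: red_subst => //; apply: gtR.
have l2p1 : subterm_at (subst sigma2 l2) p = Some (subst sigma1 l1).
  by rewrite l1u; apply: subterm_at_subst.
have s_r1 : gt (subst sigma2 l2)
    (replace_at (subst sigma2 l2) p (subst sigma1 r1)).
  by apply: gt_replaceE l2p1 _; apply: red_subst => //; apply: gtR.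
have := pcpR (delta := delta) (s := subst sigma2 l2) pcp.
rewrite (subst_replace_at _ _ l2sp) -!tauE tl2 tr1 tr2 => pcpR'.
by apply: conv_in_sym; apply: pcpR'.
Qed.

Lemma prime_root_peak_connected l1 r1 l2 r2 p sigma1 sigma2 :
  R (l1, r1) -> R (l2, r2) ->
  subterm_at (subst sigma2 l2) p = Some (subst sigma1 l1) ->
  (forall q w, q <> [::] -> subterm_at (subst sigma1 l1) q = Some w ->
     normal_form R w) ->
  conv_in (gt (subst sigma2 l2)) R (subst sigma2 r2)
    (replace_at (subst sigma2 l2) p (subst sigma1 r1)).
Proof.
move=> R1 R2 l2p prime.
have [[u [l2u uV l1u]]|] := subterm_at_subst_inv l2p.
  exact: prime_overlap_connected R1 R2 l2u uV l1u prime.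
(* Variable overlap: both reducts reach the instance of [r2] in which the value of [x] has been
   contracted. *)
move=> [p1 [p2 [x [pE l2x xp]]]].
have xstep : rsteps R (sigma2 x) (replace_at (sigma2 x) p2 (subst sigma1 r1)).
  rewrite -{1}(replace_at_id xp).
  exact: rsteps_replace xp (rt_step _ _ _ _ (rstep_root _ R1)).
apply: joinable_conv_in => //.
- by apply: red_subst => //; apply: gtR.
- by apply: gt_replaceE l2p _; apply: red_subst => //; apply: gtR.
exists (subst (update sigma2 x
    (replace_at (sigma2 x) p2 (subst sigma1 r1))) r2).
  apply: rsteps_subst_pointwise => y.
  case: (pselect (y = x)) => [->|yx]; first by rewrite update_same.
  by rewrite update_other //; apply: rt_refl.
rewrite pE; apply: rt_trans (rsteps_replace_var l2x xstep) _.
by apply: rt_step; apply: rstep_root.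
Qed.

(** Induction on the size of [v]: descend into a reducible proper subterm while there is one;
    otherwise the redex of [v] can only sit at its root. *)
Lemma innermost_redex t v q : subterm_at t q = Some v -> ~ normal_form R v ->
  exists q' l r sigma, [/\ R (l, r),
    subterm_at t (q ++ q') = Some (subst sigma l)
    & forall q'' w, q'' <> [::] -> subterm_at (subst sigma l) q'' = Some w ->
        normal_form R w].
Proof.
elim: (term_size v).+1 {-2}v q (ltnSn (term_size v)) => // n IH {}v q vn tq.
move=> vred.
case: (pselect (forall q' w, q' <> [::] -> subterm_at v q' = Some w ->
    normal_form R w)) => [vprime|].
  move/existsNP: vred => [v' /contrapT[l [r [p [sigma [Rlr vp _]]]]]].
  have p0 : p = [::].
    by apply: contrapT => /vprime/(_ vp); apply; apply: rstep_root Rlr.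
  move: vp vprime tq; rewrite p0 => -[->] vprime tq.
  by exists [::], l, r, sigma; rewrite cats0.
move=> /existsNP[q1 /existsNP[w /not_implyP[q1_0 /not_implyP[vw wred]]]].
have wn : term_size w < n.
  by apply: leq_trans (term_size_subterm_at q1_0 vw) _; rewrite -ltnS.
have [||q' [l [r [sigma]]]] := IH w (q ++ q1) wn => //.
  by rewrite subterm_at_cat tq.
by rewrite -catA => ?; exists (q1 ++ q'), l, r, sigma.
Qed.

(* If the inner redex is not prime, contracting an innermost redex properly
   below it splits the peak into two peaks whose inner redex is prime. *)
Lemma root_peak_connected l1 r1 l2 r2 p sigma1 sigma2 :
  R (l1, r1) -> R (l2, r2) ->
  subterm_at (subst sigma2 l2) p = Some (subst sigma1 l1) ->
  conv_in (gt (subst sigma2 l2)) R (subst sigma2 r2)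
    (replace_at (subst sigma2 l2) p (subst sigma1 r1)).
Proof.
move=> R1 R2 l2p.
case: (pselect (forall q w, q <> [::] ->
    subterm_at (subst sigma1 l1) q = Some w -> normal_form R w)).
  exact: prime_root_peak_connected.
move=> /existsNP[q /existsNP[w /not_implyP[q0 /not_implyP[qw]]]].
move=> /(innermost_redex qw)[q' [l3 [r3 [sigma3 [R3 l1q prime]]]]].
set s := subst sigma2 l2 in l2p *.
have spq : subterm_at s (p ++ (q ++ q')) = Some (subst sigma3 l3).
  by rewrite subterm_at_cat l2p.
apply: (rt_trans _ _ _ (replace_at s (p ++ (q ++ q')) (subst sigma3 r3))).
  exact: prime_root_peak_connected R3 R2 spq prime.
apply: conv_in_sym; rewrite (replace_at_cat _ _ l2p).
(* The second peak has source [subst sigma1 l1]; terms below that source give terms below [s] when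
   placed at [p]. *)
apply: (conv_in_replace (D := gt (subst sigma1 l1)) l2p).
  by move=> v; apply: gt_replaceE.
exact: prime_root_peak_connected R3 R1 l1q prime.
Qed.

(** The common prefix of the two positions is stripped until one redex contains the other or the
    redexes are parallel, in which case the steps commute. *)
Lemma peak_connected s t u : rstep R s t -> rstep R s u -> conv_in (gt s) R t u.
Proof.
move=> [l2 [r2 [p2 [sigma2 [R2 sp2 ->]]]]] [l1 [r1 [p1 [sigma1 [R1 sp1 ->]]]]].
elim: p2 p1 s sp2 sp1 => [|i p2 IH] p1 s.
  move=> [->]; exact: root_peak_connected.
case: p1 => [sp2 [sE]|j p1].
  by apply: conv_in_sym; move: sp2; rewrite sE; apply: root_peak_connected.
move=> sp2 sp1; case: (eqVneq i j) => [ij|ij].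
  rewrite -{}ij in sp1 *; move: sp1.
  have [f [ts [a [-> -> tsp2]]]] := subterm_at_cons sp2.
  rewrite subterm_at_arg => tsp1; rewrite -(cat1s _ p1) -(cat1s _ p2).
  have ts_a : subterm_at (App ts) [:: val a] = Some (ts a).
    by rewrite subterm_at_arg.
  rewrite (replace_at_cat p1 _ ts_a) (replace_at_cat p2 _ ts_a).
  apply: (conv_in_replace (D := gt (ts a)) ts_a); last exact: IH.
  by move=> v; apply: gt_replaceE.
have rule_gt l r sigma : R (l, r) -> gt (subst sigma l) (subst sigma r).
  by move=> /gtR/(red_subst gt_red sigma).
apply: joinable_conv_in => //.
- exact: gt_replaceE sp2 (rule_gt _ _ _ R2).
- exact: gt_replaceE sp1 (rule_gt _ _ _ R1).
exists (replace_at (replace_at s (i :: p2) (subst sigma2 r2)) (j :: p1)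
         (subst sigma1 r1)).
  apply: rt_step; exists l1, r1, (j :: p1), sigma1; split=> //.
  by rewrite subterm_at_replace_par.
rewrite replace_at_par //.
apply: rt_step; exists l2, r2, (i :: p2), sigma2; split=> //.
by rewrite subterm_at_replace_par // eq_sym.
Qed.

End Peaks.

(** * Invariants along a run *)

Section Run.
Context (E : eqsys F V) (n : nat) (Es Rs : nat -> eqsys F V)
  (run : finite_run gt E n Es Rs).

Lemma run_oriented i : i <= n -> oriented gt (Rs i).
Proof.
case: run => _ R0 step; elim: i => [_|i IH i_n]; first by rewrite R0.
exact: (kb_step_oriented (step i i_n)) (IH (ltnW i_n)).
Qed.

Lemma run_conv_in D i j s t : (forall s t, D s -> gt s t -> D t) ->
  i <= j <= n -> conv_in D (Es i `|` Rs i) s t -> conv_in D (Es j `|` Rs j) s t.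
Proof.
move=> Ddown; elim: j => [|j IH] /andP[ij jn].
  by move: ij; rewrite leqn0 => /eqP ->.
move: ij; rewrite leq_eqVlt ltnS => /predU1P[->//|ij] st.
have [_ _ /(_ j jn) step] := run.
apply: (conv_in_pairs Ddown (kb_step_conv_in step (run_oriented (ltnW jn)))).
by apply: IH => //; rewrite ij ltnW.
Qed.

(** From [E] to stage [i], [run_conv_in] applies with the set of all terms; in the other direction
    the inference steps are undone one at a time. *)
Lemma run_conversion i s t : i <= n ->
  conversion (Es i `|` Rs i) s t <-> conversion E s t.
Proof.
have [E0 R0 step] := run; have E0R0 : Es 0 `|` Rs 0 = E by rewrite E0 R0 setU0.
move=> i_n; split; last first.
  rewrite -E0R0 => /conversion_conv_in st.
  by apply: conv_in_conversion; apply: run_conv_in st.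
elim: i i_n => [_|i IH i_n]; first by rewrite E0R0.
move=> /(conversion_pairs (kb_step_conversion (step i i_n))).
exact/IH/ltnW.
Qed.

End Run.

End Order.

End Terms.

Theorem theorem3p8 (F : signature) (V : Type)
    (V_infinite : infinite_set [set: V]%classic)
    (gt : term F V -> term F V -> Prop) (gt_red : reduction_order gt)
    (E : eqsys F V) (n : nat) (Es Rs : nat -> eqsys F V)
    (run : finite_run gt E n Es Rs) (run_fair : fair n Es Rs) :
  complete_presentation (Rs n) E.
Proof.
have [En0 PCPn] := run_fair.
have EnRn : Es n `|` Rs n = Rs n by rewrite En0 set0U.
have gtR : oriented gt (Rs n) := run_oriented gt_red run (leqnn n).
split.
- exact: oriented_is_trs gtR.
- split; first exact: oriented_terminating gtR.
  apply: (connected_below_confluent gt_red gtR) => s t u.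
  apply: (peak_connected gt_red V_infinite gtR) => a b delta w.
  move=> /PCPn[[v av bv] wa wb|[i i_n ab] wa wb].
    apply: joinable_conv_in => //.
    by exists (subst delta v); apply: rsteps_subst.
  (* The instance is a single step of stage [i] between terms below [w]. The set of these terms is
     closed under [gt], so the step is carried to stage [n], where only the rules remain. *)
  rewrite -EnRn; apply: (run_conv_in gt_red run (i := i)).
  + by move=> x y; apply: red_trans.
  + by rewrite i_n leqnn.
  + apply: rt_step; split=> //; apply: sym_step_subst.
    by apply: sym_step_sub ab => x; left.
- by move=> s t; rewrite -[in conversion _]EnRn; apply: (run_conversion gt_red run).
Qed.
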